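(* The function $m:\mathbb{R}\to\mathbb{R}$ does not satisfy the recursive formula $$m(x)=\begin{cases}-x & \text{if } x<0,\\ \tfrac12\, m\bigl(x-m(x-1)\bigr) & \text{if } x\ge 0;\end{cases}$$ that is, it is not the case that this identity holds for all $x\in\mathbb{R}$.
   Context: The fuse operation is the partial binary operation on real numbers $a\sim b=(a+b+1)/2$, applicable only when $|a-b|<1$. A fusible number is a real number obtainable from $0$ by finitely many (valid) applications of the fuse operation; i.e. the set $\mathcal{F}$ of fusible numbers is the smallest subset of $\mathbb{R}$ such that $0\in\mathcal{F}$ and, whenever $a,b\in\mathcal{F}$ and $|a-b|<1$, also $(a+b+1)/2\in\mathcal{F}$. The set $\mathcal{F}$ is well-ordered by the usual order of $\mathbb{R}$. For $a\in\mathbb{R}$ define $s(a)=\min\{b\in\mathcal{F}: b>a\}$ and $m(a)=s(a)-a$. *)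

(* Defs.v *)
From Stdlib Require Import Reals ClassicalEpsilon.
Open Scope R_scope.

Definition fuse (a b : R) : R := (a + b + 1) / 2.

Inductive fusible : R -> Prop :=
| fusible_zero : fusible 0
| fusible_fuse (a b : R) :
    fusible a -> fusible b -> Rabs (a - b) < 1 -> fusible (fuse a b).

Definition is_min (A : R -> Prop) (x : R) : Prop :=
  A x /\ forall y : R, A y -> x <= y.

(* The fusible numbers are well-ordered and unbounded above, so this minimum
   exists for every a; no fallback value of epsilon is ever involved. *)
Definition s (a : R) : R :=
  epsilon (inhabits 0) (is_min (fun b => fusible b /\ b > a)).

Definition m (a : R) : R := s a - a.

(* Main.v *)
Require Import Defs.
From Stdlib Require Import Reals Lra Classical ClassicalEpsilon.
Open Scope R_scope.

(** The recursion for [m x] only fuses [a = s (x - 1)] with the least admissible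
    [b], but a larger [a] can do better.  At [x = 33/16] the recursion gives
    [m x = 1/2048]: it takes [a = 9/8] and [b = 2 + 1/1024].  The larger fusible
    number [a = 19/16] fuses with [b = 31/16 + 1/2048] to [x + 1/4096].

    This contradicts the minimality of [s x] once [s] is known to attain its
    minimum, for which it is enough that every real is isolated from the
    fusible numbers above it.  That is shown by induction along the real line. *)

(** If [P] failed at [z], the set [E] of points below which [P] holds everywhere would be bounded by
    [z]. Its supremum [e] again lies in [E], and the step at [e] puts [e + d] in [E]. *)
Lemma real_induction (P : R -> Prop) (x0 : R) :
  (forall y, y < x0 -> P y) ->
  (forall x, (forall y, y < x -> P y) ->
     exists d, 0 < d /\ forall y, x <= y < x + d -> P y) ->
  forall x, P x.
Proof.
intros H0 Hstep z; apply NNPP; intros Hz.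
set (E := fun x => forall y, y < x -> P y).
assert (Eub : bound E).
{ exists z; intros x Ex; destruct (Rle_lt_dec x z) as [|Hlt]; [assumption|].
  now destruct Hz; apply Ex. }
assert (Ene : exists x, E x) by (exists x0; exact H0).
destruct (completeness E Eub Ene) as [e [He1 He2]].
assert (Ee : forall y, y < e -> P y).
{ intros y Hy; apply NNPP; intros Py.
  assert (e <= y); [|lra].
  apply He2; intros x Ex; destruct (Rle_lt_dec x y) as [|Hlt]; [assumption|].
  now destruct Py; apply Ex. }
destruct (Hstep e Ee) as [d [Hd Pd]].
assert (E (e + d)) as Ed.
{ intros y Hy; destruct (Rlt_le_dec y e); [now apply Ee|apply Pd; lra]. }
specialize (He1 _ Ed); lra.
Qed.

Lemma fusible_nonneg (a : R) : fusible a -> 0 <= a.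
Proof. induction 1; unfold fuse in *; lra. Qed.

Lemma fusible_pos_inv (a : R) :
  fusible a -> 0 < a ->
  exists b c, fusible b /\ fusible c /\ b <= c < b + 1 /\ a = fuse b c.
Proof.
intros Ha; destruct Ha as [|b c Hb Hc Hbc]; intros Hpos; [lra|].
apply Rabs_def2 in Hbc.
destruct (Rle_lt_dec b c).
- exists b, c; repeat split; auto; lra.
- exists c, b; repeat split; auto; unfold fuse; lra.
Qed.

Definition right_gap (x : R) : Prop :=
  exists d, 0 < d /\ forall a, fusible a -> x < a < x + d -> False.

(* A pair (b, c) with b near z and b + c slightly above 2 x - 1 has b in the
   gap right of z or c in the gap right of 2 x - 1 - z; real induction on z
   makes this uniform. *)
Lemma fusible_sum_gap (x l : R) :
  x - 1 < l -> (forall y, y < x -> right_gap y) ->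
  exists d, 0 < d /\
    forall b c, fusible b -> fusible c -> l <= b <= x - 1 / 4 ->
      2 * x - 1 < b + c < 2 * x - 1 + d -> False.
Proof.
intros Hl Hgap.
enough (Hz : forall z, exists d, 0 < d /\
    forall b c, fusible b -> fusible c -> l <= b <= x - 1 / 4 -> b <= z ->
      2 * x - 1 < b + c < 2 * x - 1 + d -> False).
{ destruct (Hz x) as [d [Hd Hno]].
  exists d; split; [assumption|]; intros b c Hb Hc Hlb Hbc.
  apply (Hno b c); auto; lra. }
apply (real_induction _ l).
- intros z Hz; exists 1; split; [lra|]; intros; lra.
- intros z IH.
  destruct (Rlt_le_dec z l) as [Hzl|Hzl].
  { exists (l - z); split; [lra|]; intros y Hy.
    exists 1; split; [lra|]; intros; lra. }
  destruct (Rlt_le_dec (x - 1 / 4) z) as [Hzx|Hzx].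
  { exists 1; split; [lra|]; intros y Hy.
    destruct (IH (x - 1 / 4) Hzx) as [d [Hd Hno]].
    exists d; split; [assumption|]; intros b c Hb Hc Hlb Hby Hbc.
    apply (Hno b c); auto; lra. }
  (* Both points lie below [x]: the first as [z <= x - 1 / 4], the second as [z >= l > x - 1]. *)
  destruct (Hgap z) as [d1 [Hd1 Hno1]]; [lra|].
  destruct (Hgap (2 * x - 1 - z)) as [d2 [Hd2 Hno2]]; [lra|].
  pose proof (Rmin_l d1 d2); pose proof (Rmin_r d1 d2).
  pose proof (Rmin_pos d1 d2 Hd1 Hd2).
  (* If [z - e / 2 < b <= z], then [c] exceeds [2 * x - 1 - z] by less than [3 / 2 * e]; if
     [z < b <= y], then [b] exceeds [z] by less than [e]. Smaller [b] fall to the induction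
     hypothesis. *)
  set (e := Rmin d1 d2 / 2) in *.
  assert (0 < e /\ e < d1 /\ 3 / 2 * e < d2) by (unfold e; lra).
  destruct (IH (z - e / 2)) as [d0 [Hd0 Hno0]]; [lra|].
  exists e; split; [lra|]; intros y Hy.
  exists (Rmin d0 e); split; [apply Rmin_pos; lra|].
  pose proof (Rmin_l d0 e); pose proof (Rmin_r d0 e).
  intros b c Hb Hc Hlb Hby Hbc.
  destruct (Rle_lt_dec b (z - e / 2)); [apply (Hno0 b c); auto; lra|].
  destruct (Rle_lt_dec b z).
  + apply (Hno2 c); auto; lra.
  + apply (Hno1 b); auto; lra.
Qed.

(** For [x >= 0], let [a = fuse b c] lie just above [x], with [b <= c < b + 1]. Then
    [b > a - 1 > x - 1], so the gap right of [x - 1] keeps [b] at distance at least [h] from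
    [x - 1], and [fusible_sum_gap] excludes the rest. *)
Lemma right_gap_step (x : R) : (forall y, y < x -> right_gap y) -> right_gap x.
Proof.
intros Hgap.
destruct (Rlt_le_dec x 0) as [Hx|Hx].
{ exists (- x); split; [lra|]; intros a Ha Hax.
  apply fusible_nonneg in Ha; lra. }
destruct (Hgap (x - 1)) as [h [Hh Hno]]; [lra|].
destruct (fusible_sum_gap x (x - 1 + h)) as [d [Hd Hsum]]; [lra|assumption|].
(* [d / 2] because [b + c = 2 * a - 1]; [1 / 4] because [b <= a - 1 / 2] must give
   [b <= x - 1 / 4]. *)
exists (Rmin (d / 2) (1 / 4)); split; [apply Rmin_pos; lra|].
pose proof (Rmin_l (d / 2) (1 / 4)); pose proof (Rmin_r (d / 2) (1 / 4)).
intros a Ha Hax.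
destruct (fusible_pos_inv a Ha) as (b & c & Hb & Hc & Hbc & ->); [lra|].
unfold fuse in *.
destruct (Rlt_le_dec b (x - 1 + h)).
- apply (Hno b); auto; lra.
- apply (Hsum b c); auto; lra.
Qed.

Lemma fusible_right_gap (x : R) : right_gap x.
Proof.
revert x; apply (real_induction _ 0).
- intros y Hy; exists (- y); split; [lra|]; intros a Ha Hay.
  apply fusible_nonneg in Ha; lra.
- intros x IH.
  destruct (right_gap_step x IH) as [d [Hd Hno]].
  exists d; split; [assumption|]; intros y Hy.
  exists (x + d - y); split; [lra|]; intros a Ha Hay.
  apply (Hno a); auto; lra.
Qed.

Lemma fusible_unbounded (a : R) : exists b, fusible b /\ b > a.
Proof.
assert (Hn : forall n, fusible (INR n / 2)).
{ induction n as [|n IH].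
  - replace (INR 0 / 2) with 0 by (simpl; lra); constructor.
  - replace (INR (S n) / 2) with (fuse (INR n / 2) (INR n / 2))
      by (rewrite S_INR; unfold fuse; lra).
    constructor; auto; rewrite Rminus_diag, Rabs_R0; lra. }
destruct (INR_unbounded (2 * a)) as [n Hna].
exists (INR n / 2); split; [apply Hn|lra].
Qed.

Lemma s_is_min (a : R) : is_min (fun b => fusible b /\ b > a) (s a).
Proof.
unfold s; apply epsilon_spec.
set (A := fun b => fusible b /\ b > a).
set (E := fun l => forall b, A b -> l <= b).
destruct (fusible_unbounded a) as [u Hu].
assert (Eub : bound E) by (exists u; intros l El; now apply El).
assert (Ene : exists l, E l) by (exists a; intros b [_ Hb]; lra).
destruct (completeness E Eub Ene) as [i [Hi1 Hi2]].
assert (Hi : forall b, A b -> i <= b).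
{ intros b Ab; apply Hi2; intros l El; now apply El. }
exists i; split; [|exact Hi].
(* If the infimum [i] were not attained, the gap to its right would make [i + d] a lower bound
   too. *)
apply NNPP; intros HA.
destruct (fusible_right_gap i) as [d [Hd Hno]].
assert (E (i + d)) as Ed.
{ intros b Ab; destruct (Rle_lt_dec (i + d) b) as [|Hlt]; [assumption|].
  exfalso; destruct (Hi b Ab) as [Hib | <-]; [|contradiction].
  apply (Hno b); [apply Ab|lra]. }
specialize (Hi1 _ Ed); lra.
Qed.

Lemma fusible_of_m (x v : R) : m x = v -> fusible (x + v).
Proof.
intros <-; unfold m; replace (x + (s x - x)) with (s x) by ring.
apply s_is_min.
Qed.

Lemma m_le (x y : R) : fusible y -> x < y -> m x <= y - x.
Proof.
intros Hy Hxy; unfold m; enough (s x <= y) by lra.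
now apply s_is_min.
Qed.

Theorem mainTheorem3 :
  ~ (forall x : R,
       m x = if Rlt_dec x 0 then - x else 1 / 2 * m (x - m (x - 1))).
Proof.
intros H.
assert (neg : forall x, x < 0 -> m x = - x).
{ intros x Hx; rewrite H; destruct (Rlt_dec x 0); [reflexivity|lra]. }
(* One step of the recursion with its arguments and values as variables, so that each table entry
   below reduces to linear arithmetic. *)
assert (rec : forall x y u z v w, m y = u -> m z = v -> 0 <= x ->
    y = x - 1 -> z = x - u -> w = v / 2 -> m x = w).
{ intros x y u z v w Hu Hv Hx -> -> ->; rewrite H.
  destruct (Rlt_dec x 0); [lra|]; rewrite Hu, Hv; lra. }
assert (m_1_16 : m (1 / 16) = 7 / 16)
  by (apply (rec _ _ _ _ _ _ (neg (-15 / 16) ltac:(lra)) (neg (-7 / 8) ltac:(lra))); lra).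
assert (m_1_4 : m (1 / 4) = 1 / 4)
  by (apply (rec _ _ _ _ _ _ (neg (-3 / 4) ltac:(lra)) (neg (-1 / 2) ltac:(lra))); lra).
assert (m_5_8 : m (5 / 8) = 1 / 8)
  by (apply (rec _ _ _ _ _ _ (neg (-3 / 8) ltac:(lra)) m_1_4); lra).
assert (m_17_16 : m (17 / 16) = 1 / 16)
  by (apply (rec _ _ _ _ _ _ m_1_16 m_5_8); lra).
assert (m_0 : m (0) = 1 / 2)
  by (apply (rec _ _ _ _ _ _ (neg (-1) ltac:(lra)) (neg (-1) ltac:(lra))); lra).
assert (m_1_2 : m (1 / 2) = 1 / 4)
  by (apply (rec _ _ _ _ _ _ (neg (-1 / 2) ltac:(lra)) m_0); lra).
assert (m_1 : m (1) = 1 / 8)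
  by (apply (rec _ _ _ _ _ _ m_0 m_1_2); lra).
assert (m_3_4 : m (3 / 4) = 1 / 8)
  by (apply (rec _ _ _ _ _ _ (neg (-1 / 4) ltac:(lra)) m_1_2); lra).
assert (m_7_8 : m (7 / 8) = 1 / 16)
  by (apply (rec _ _ _ _ _ _ (neg (-1 / 8) ltac:(lra)) m_3_4); lra).
assert (m_13_16 : m (13 / 16) = 1 / 16)
  by (apply (rec _ _ _ _ _ _ (neg (-3 / 16) ltac:(lra)) m_5_8); lra).
assert (m_5_4 : m (5 / 4) = 1 / 16)
  by (apply (rec _ _ _ _ _ _ m_1_4 m_1); lra).
assert (m_3_2 : m (3 / 2) = 1 / 32)
  by (apply (rec _ _ _ _ _ _ m_1_2 m_5_4); lra).
assert (m_13_8 : m (13 / 8) = 1 / 64)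
  by (apply (rec _ _ _ _ _ _ m_5_8 m_3_2); lra).
assert (m_7_4 : m (7 / 4) = 1 / 128)
  by (apply (rec _ _ _ _ _ _ m_3_4 m_13_8); lra).
assert (m_29_16 : m (29 / 16) = 1 / 256)
  by (apply (rec _ _ _ _ _ _ m_13_16 m_7_4); lra).
assert (m_15_8 : m (15 / 8) = 1 / 512)
  by (apply (rec _ _ _ _ _ _ m_7_8 m_29_16); lra).
assert (m_2 : m (2) = 1 / 1024)
  by (apply (rec _ _ _ _ _ _ m_1 m_15_8); lra).
assert (m_33_16 : m (33 / 16) = 1 / 2048)
  by (apply (rec _ _ _ _ _ _ m_17_16 m_2); lra).
(* The remaining entries lead to [m (9 / 8)] and [m (31 / 16)], the source of the two better
   summands. *)
assert (m_1_8 : m (1 / 8) = 3 / 8)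
  by (apply (rec _ _ _ _ _ _ (neg (-7 / 8) ltac:(lra)) (neg (-3 / 4) ltac:(lra))); lra).
assert (m_9_8 : m (9 / 8) = 1 / 16)
  by (apply (rec _ _ _ _ _ _ m_1_8 m_3_4); lra).
assert (m_15_16 : m (15 / 16) = 1 / 32)
  by (apply (rec _ _ _ _ _ _ (neg (-1 / 16) ltac:(lra)) m_7_8); lra).
assert (m_29_32 : m (29 / 32) = 1 / 32)
  by (apply (rec _ _ _ _ _ _ (neg (-3 / 32) ltac:(lra)) m_13_16); lra).
assert (m_61_32 : m (61 / 32) = 1 / 1024)
  by (apply (rec _ _ _ _ _ _ m_29_32 m_15_8); lra).
assert (m_31_16 : m (31 / 16) = 1 / 2048)
  by (apply (rec _ _ _ _ _ _ m_15_16 m_61_32); lra).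
(* The summands differ by [3 / 4 + 1 / 2048], so the fuse is valid. *)
assert (Hf : fusible (fuse (9 / 8 + 1 / 16) (31 / 16 + 1 / 2048))).
{ constructor; [now apply fusible_of_m..|apply Rabs_def1; lra]. }
pose proof (m_le (33 / 16) _ Hf) as Hle; unfold fuse in Hle; lra.
Qed.
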